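(* $$\sum_{n\ge0}E_n^{B,+}\frac{x^n}{n!}=\frac{\sec 2x+\tan 2x+1}{2},\quad \sum_{n\ge0}E_n^{B,-}\frac{x^n}{n!}=\frac{\sec 2x+\tan 2x-1}{2},$$ $$\sum_{n\ge0}E_n^{D}\frac{x^n}{n!}=\frac{\sec 2x+\tan 2x+1}{2},\quad \sum_{n\ge0}E_n^{B-D}\frac{x^n}{n!}=\frac{\sec 2x+\tan 2x-1}{2}.$$
   Context: $\mathfrak{B}_n$ is the group of signed permutations in window notation $\pi=\pi_1\cdots\pi_n$ ($\pi_i\in\{\pm1,\dots,\pm n\}$, $\{|\pi_i|\}=[n]$), with $\mathrm{inv}_B(\pi)=|\{i<j:\pi_i>\pi_j\}|+|\{i<j:-\pi_i>\pi_j\}|+|\{i:\pi_i<0\}|$; $\mathfrak{B}_n^+$ consists of those with $\mathrm{inv}_B$ even, $\mathfrak{B}_n^-$ of those with $\mathrm{inv}_B$ odd; $\mathfrak{D}_n$ is the subset with an even number of negative entries. $\pi\in\mathfrak{B}_n$ is alternating if $\pi_1>\pi_2<\pi_3>\pi_4<\cdots$ in the usual order on $\mathbb{Z}$. For $n\ge1$, $E_n^{B,\pm}$ is the number of alternating $\pi\in\mathfrak{B}_n^{\pm}$, $E_n^D$ the number of alternating $\pi\in\mathfrak{D}_n$, and $E_n^{B-D}$ the number of alternating $\pi\in\mathfrak{B}_n\setminus\mathfrak{D}_n$. Conventions: $E_0^{B,+}=E_0^D=1$, $E_0^{B,-}=E_0^{B-D}=0$. *)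

(* Defs.v *)
From mathcomp Require Import all_boot all_order all_algebra perm.

Set Implicit Arguments.
Unset Strict Implicit.
Unset Printing Implicit Defensive.

Import Order.TTheory GRing.Theory Num.Theory.
Local Open Scope ring_scope.

(* A pair (s, e) stands for the signed permutation of [n] whose i-th entry has
   absolute value s i and is negative iff e i holds; 'I_n is 0-based, whence
   the (s i).+1 in [window]. Lemma [windowP] below shows that this encodes
   each admissible window exactly once. *)
Notation signed_perm n := ('S_n * {ffun 'I_n -> bool})%type.

Definition window n (p : signed_perm n) (i : 'I_n) : int :=
  (-1) ^+ p.2 i * (p.1 i).+1%:Z.

Definition invB n (p : signed_perm n) : nat :=
  (#|[set ij : 'I_n * 'I_n |
       (ij.1 < ij.2)%N && (window p ij.1 > window p ij.2)%R]|
   + #|[set ij : 'I_n * 'I_n |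
       (ij.1 < ij.2)%N && (- window p ij.1 > window p ij.2)%R]|
   + #|[set i : 'I_n | (window p i < 0)%R]|)%N.

Definition in_Bplus n (p : signed_perm n) : bool := ~~ odd (invB p).

Definition in_Bminus n (p : signed_perm n) : bool := odd (invB p).

Definition in_D n (p : signed_perm n) : bool :=
  ~~ odd #|[set i : 'I_n | window p i < 0]|.

(* Descents are at odd positions 1, 3, ..., i.e. at even 0-based indices. *)
Definition alternating n (p : signed_perm n) : bool :=
  [forall i : 'I_n, forall j : 'I_n, (j == i.+1 :> nat) ==>
    (if odd i then window p i < window p j else window p i > window p j)].

(* For n = 0 the only (empty) signed permutation is alternating with
   invB = 0, so these counts agree with the conventions 1, 0, 1, 0;
   see [numB0]. *)
Definition numBplus n : nat :=
  #|[set p : signed_perm n | alternating p && in_Bplus p]|.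

Definition numBminus n : nat :=
  #|[set p : signed_perm n | alternating p && in_Bminus p]|.

Definition numD n : nat :=
  #|[set p : signed_perm n | alternating p && in_D p]|.

Definition numBD n : nat :=
  #|[set p : signed_perm n | alternating p && ~~ in_D p]|.

(* Formal power series over rat, as coefficient sequences; equality of
   series is coefficientwise, =1. *)
Definition fps := nat -> rat.

Declare Scope fps_scope.
Delimit Scope fps_scope with F.
Bind Scope fps_scope with fps.

Definition fps_one : fps := fun n => (n == 0%N)%:R.
Definition fps_add (f g : fps) : fps := fun n => f n + g n.
Definition fps_opp (f : fps) : fps := fun n => - f n.
Definition fps_scale (c : rat) (f : fps) : fps := fun n => c * f n.
Definition fps_mul (f g : fps) : fps :=
  fun n => \sum_(i < n.+1) f i * g (n - i)%N.

(* First n coefficients of 1/f, obtained by solving f * g = 1 degree by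
   degree; meaningful when f 0 != 0, see [fps_mulfV]. *)
Fixpoint fps_inv_coefs (f : fps) (n : nat) : seq rat :=
  if n is m.+1 then
    let s := fps_inv_coefs f m in
    rcons s (((m == 0%N)%:R - \sum_(i < m) s`_i * f (m - i)%N) / f 0%N)
  else [::].

Definition fps_inv (f : fps) : fps := fun n => (fps_inv_coefs f n.+1)`_n.

(* The series f(c x). *)
Definition fps_dilate (c : rat) (f : fps) : fps := fun n => c ^+ n * f n.

Definition egf (a : nat -> nat) : fps := fun n => (a n)%:R / n`!%:R.

Notation "1" := fps_one : fps_scope.
Notation "f + g" := (fps_add f g) : fps_scope.
Notation "- f" := (fps_opp f) : fps_scope.
Notation "f - g" := (fps_add f (fps_opp g)) : fps_scope.
Notation "f * g" := (fps_mul f g) : fps_scope.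
Notation "f / g" := (fps_mul f (fps_inv g)) : fps_scope.
Notation "c *: f" := (fps_scale c%R f) : fps_scope.

Definition fps_cos : fps :=
  fun n => if odd n then 0 else (-1) ^+ n./2 / n`!%:R.
Definition fps_sin : fps :=
  fun n => if odd n then (-1) ^+ n./2 / n`!%:R else 0.
Definition fps_sec : fps := (1 / fps_cos)%F.
Definition fps_tan : fps := (fps_sin / fps_cos)%F.

Definition sec2x : fps := fps_dilate 2 fps_sec.
Definition tan2x : fps := fps_dilate 2 fps_tan.

Lemma size_fps_inv_coefs f n : size (fps_inv_coefs f n) = n.
Proof. by elim: n => //= n IHn; rewrite size_rcons IHn. Qed.

Lemma nth_fps_inv_coefs f n i :
  (i < n)%N -> (fps_inv_coefs f n)`_i = fps_inv f i.
Proof.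
elim: n => // n IHn; rewrite ltnS leq_eqVlt => /predU1P[-> //|lt_in].
by rewrite /= nth_rcons size_fps_inv_coefs lt_in IHn.
Qed.

Lemma fps_invE f n : fps_inv f n =
  ((n == 0%N)%:R - \sum_(i < n) fps_inv f i * f (n - i)%N) / f 0%N.
Proof.
rewrite {1}/fps_inv /= nth_rcons size_fps_inv_coefs ltnn eqxx.
by congr ((_ - _) / _); apply: eq_bigr => i _; rewrite nth_fps_inv_coefs.
Qed.

Lemma fps_mulC f g : (f * g =1 g * f)%F.
Proof.
move=> n; rewrite /fps_mul (reindex_inj rev_ord_inj) /=.
by apply: eq_bigr => i _; rewrite subSS subKn 1?mulrC // -ltnS.
Qed.

Lemma fps_mulfV f : f 0%N != 0 -> (f * fps_inv f =1 1)%F.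
Proof.
move=> f0 n; rewrite fps_mulC /fps_mul big_ord_recr /= subnn fps_invE.
by rewrite divfK // addrC subrK.
Qed.

Lemma absz_window n (p : signed_perm n) i : `|window p i|%N = (p.1 i).+1.
Proof. by rewrite /window abszMsign. Qed.

Lemma window_lt0 n (p : signed_perm n) i : (window p i < 0) = p.2 i.
Proof. by rewrite /window; case: (p.2 i); rewrite ?mulN1r ?mul1r. Qed.

Lemma windowP n (w : 'I_n -> int) :
    injective (fun i => `|w i|%N) -> (forall i, (0 < `|w i| <= n)%N) ->
  exists! p : signed_perm n, window p =1 w.
Proof.
move=> w_inj w_bd.
have lt_w i : (`|w i|.-1 < n)%N by have/andP[w0 wn] := w_bd i; rewrite prednK.
have s_inj : injective (fun i => Ordinal (lt_w i)).
  move=> i j [] eq_ij; apply: w_inj; have/andP[wi _] := w_bd i.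
  by have/andP[wj _] := w_bd j; rewrite -(prednK wi) eq_ij prednK.
exists (perm s_inj, [ffun i => w i < 0]); split=> [i|[s e] /= def_w].
  rewrite /window permE ffunE /= prednK; last by case/andP: (w_bd i).
  by rewrite abszE -intEsign.
congr (_, _); last by apply/ffunP=> i; rewrite ffunE -def_w window_lt0.
by apply/permP=> i; apply/val_inj; rewrite permE /= -def_w absz_window.
Qed.

Lemma numB0 :
  [/\ numBplus 0 = 1%N, numBminus 0 = 0%N, numD 0 = 1%N & numBD 0 = 0%N].
Proof.
have card0 (P : pred 'I_0) : #|[set i | P i]| = 0%N.
  by apply: eq_card0 => - [].
have card00 (P : pred ('I_0 * 'I_0)) : #|[set i | P i]| = 0%N.
  by apply: eq_card0 => - [[]].
have inv0 (p : signed_perm 0) : invB p = 0%N by rewrite /invB !card00 card0.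
have D0 (p : signed_perm 0) : in_D p by rewrite /in_D card0.
have alt0 (p : signed_perm 0) : alternating p by apply/forallP => - [].
have cardB : #|{: signed_perm 0}| = 1%N.
  by rewrite card_prod card_Sn card_ffun card_ord muln1.
rewrite /numBplus /numBminus /numD /numBD /in_Bplus /in_Bminus.
split; [rewrite -cardB | | rewrite -cardB |].
- by apply: eq_card => p; rewrite !inE alt0 inv0.
- by apply: eq_card0 => p; rewrite !inE inv0 andbF.
- by apply: eq_card => p; rewrite !inE alt0 D0.
- by apply: eq_card0 => p; rewrite !inE D0 andbF.
Qed.

(* Main.v *)
(** Changing the sign of the entry of absolute value 1 keeps every comparison
    of an entry with plus or minus another one, so for n > 0 it is an
    involution of the alternating signed permutations; it flips the parity of
    the number of negative entries, hence also that of inv_B.  Each of the four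
    numbers is thus half the number 2^n E_n of alternating signed permutations,
    E_n being the Euler number.  Refining E_n by the rank of the letter put in
    front of the word yields the Entringer numbers; solving their recursion in
    terms of binomial sums gives [cos * sum E_n x^n/n! = 1 + sin]. *)

Require Import Defs.
From mathcomp Require Import all_boot all_order all_algebra perm.
From mathcomp Require Import zify ring.

Set Implicit Arguments.
Unset Strict Implicit.
Unset Printing Implicit Defensive.

Import Order.TTheory GRing.Theory Num.Theory.
Local Open Scope ring_scope.

(** * Counting alternating words by ranks: the Entringer numbers *)

(* The number of words x w, with w a rearrangement of n given letters exactly j
   of which are below x, that alternate beginning with a descent. *)
Fixpoint entringer (n j : nat) : nat :=
  if n is m.+1 then (\sum_(i < j) entringer m (m - i))%N else 1%N.

Fixpoint zigzag (d : bool) (x : int) (w : seq int) : bool :=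
  if w is y :: w' then
    (if d then y < x else x < y) && zigzag (~~ d) y w'
  else true.

Lemma zigzagP d x w :
  reflect (forall i, (i < size w)%N ->
             if d (+) odd i then nth 0 (x :: w) i.+1 < nth 0 (x :: w) i
             else nth 0 (x :: w) i < nth 0 (x :: w) i.+1)
          (zigzag d x w).
Proof.
elim: w d x => [|y w IHw] d x /=; first by left.
apply: (iffP andP) => [[xy /IHw zz] [|i] lt_i|zz].
- by rewrite addbF.
- by have := zz i lt_i; rewrite /= addNb addbN.
- split; first by have := zz 0%N isT; rewrite addbF.
  by apply/IHw => i lt_i; have := zz i.+1 lt_i; rewrite /= addNb addbN.
Qed.

Definition rank (x : int) (s : seq int) := count (fun y => y < x) s.

(** If [a < x], the letters below [a] are below [x], and so is [a] itself, which lies in [s] but is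
    not counted in its own rank; this makes the comparison strict. *)
Lemma ltn_rank (s : seq int) (a x : int) :
  a \in s -> (rank a s < rank x s)%N = (a < x).
Proof.
move=> a_s; case: ltP => [lt_ax | le_xa]; last first.
  by rewrite ltnNge; apply/negbF/sub_count => y /= /lt_le_trans; apply.
have ltU: (count (predU (fun y => (y < a)%R) (pred1 a)) s <= rank x s)%N.
  by apply: sub_count => y /= /orP[/lt_trans|/eqP->//]; apply.
apply: leq_trans ltU; have := count_predUI (fun y => y < a) (pred1 a) s.
rewrite (eq_count (a2 := pred0) (a1 := predI _ _)) ?count_pred0 ?addn0 => [->|y].
  by rewrite -[X in (X < _)%N]addn0 ltn_add2l -has_count has_pred1.
by apply/andP=> -[/= lt_ya /eqP eq_ya]; rewrite eq_ya ltxx in lt_ya.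
Qed.

(** By [ltn_rank] distinct letters have distinct ranks, all smaller than [size s]; pigeonhole does
    the rest. *)
Lemma perm_ranks (s : seq int) :
  uniq s -> perm_eq [seq rank a s | a <- s] (iota 0 (size s)).
Proof.
move=> Us; have Ur : uniq [seq rank a s | a <- s].
  rewrite map_inj_in_uniq // => a b a_s b_s eq_ab; apply/eqP/negPn.
  rewrite neq_lt; apply/negP => /orP[] /[dup].
    by rewrite -{1}(ltn_rank _ a_s) eq_ab ltnn.
  by rewrite -{1}(ltn_rank _ b_s) eq_ab ltnn.
apply: uniq_perm; rewrite ?iota_uniq //.
apply: (uniq_min_size Ur _ _).2; rewrite ?size_iota ?size_map // => i.
case/mapP => a a_s ->; rewrite mem_iota /= add0n ltn_neqAle count_size andbT.
by rewrite -all_count; apply/allPn; exists a; rewrite ?ltxx.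
Qed.

Lemma sum_ranks (s : seq int) (P : pred nat) (g : nat -> nat) : uniq s ->
  (\sum_(a <- s | P (rank a s)) g (rank a s) =
   \sum_(0 <= i < size s | P i) g i)%N.
Proof.
move=> Us; rewrite -(big_map (rank^~ s) P g) (perm_big _ (perm_ranks Us)).
by rewrite /index_iota subn0.
Qed.

Lemma rank_rem (s : seq int) a : rank a (rem a s) = rank a s.
Proof.
have [a_s|/rem_id->//] := boolP (a \in s).
by rewrite /rank [RHS](seq.permP (perm_to_rem a_s)) /= ltxx.
Qed.

(** Induction on the length, splitting by the letter [a] that follows [x]: the rest must zigzag
    after [a] in the opposite direction, and removing [a] leaves its rank unchanged. Reversing the
    order exchanges the letters below [x] with those above it, which gives the argument for an
    ascent. *)
Lemma count_zigzag d x (s : seq int) : uniq s -> x \notin s ->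
  count (zigzag d x) (permutations s) =
  entringer (size s) (if d then rank x s else (size s - rank x s)%N).
Proof.
move: {2 3}(size s) (erefl (size s)) => n; elim: n s d x => [|n IHn] s d x.
  by move/size0nil->.
move=> sz_s Us x_s.
rewrite (seq.permP (permutationsE _)) ?sz_s // count_flatten sumnE !big_map.
rewrite undup_id //.
have -> : (\sum_(a <- s) count (zigzag d x)
            [seq a :: t | t <- permutations (rem a s)] =
  \sum_(a <- s | if d then rank a s < rank x s else ~~ (rank a s < rank x s))
     entringer n (if d then n - rank a s else rank a s))%N.
  rewrite big_seq [RHS]big_seq_cond big_mkcondr; apply: eq_bigr => a a_s.
  have xNa : x != a by apply: contraNneq x_s => ->.
  have sz_rem : size (rem a s) = n by rewrite size_rem // sz_s.
  rewrite ltn_rank // -leNgt le_eqVlt (negPf xNa) /= count_map.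
  have [dx|ndx] := boolP (if d then a < x else x < a).
    have eqz : preim (cons a) (zigzag d x) =1 zigzag (~~ d) a.
      by move=> t /=; rewrite dx.
    rewrite (eq_count eqz) IHn ?rem_uniq ?mem_rem_uniqF //.
    by rewrite sz_rem rank_rem; case: (d).
  rewrite (eq_count (a2 := pred0)) ?count_pred0 // => t /=.
  by rewrite (negPf ndx).
case: d => /=.
  rewrite (sum_ranks (fun i => i < rank x s)%N (fun i => entringer n (n - i))) //.
  rewrite -(big_mkord xpredT (fun i => entringer n (n - i))).
  by rewrite [RHS](big_nat_widen _ _ (size s)) ?count_size.
rewrite (sum_ranks (fun i => ~~ (i < rank x s))%N (entringer n)) //.
(* Summed from the top, index [i] stands for the letter of rank [n - i], so this is the defining
   recursion of [entringer]. *)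
transitivity (\sum_(rank x s <= i < size s) entringer n i)%N.
  rewrite [RHS](big_nat_widenl _ 0) //; apply: eq_bigl => i.
  by rewrite -leqNgt.
by rewrite big_rev_mkord sz_s; apply: eq_bigr => i _.
Qed.

(** * Alternating signed permutations as words *)

(** The words on the left are pairwise distinct rearrangements, and both lists have n! elements. *)
Lemma perm_words n (v : 'I_n -> int) : injective v ->
  perm_eq [seq [seq v (s i) | i <- enum 'I_n] | s : 'S_n]
          (permutations [seq v i | i <- enum 'I_n]).
Proof.
move=> v_inj; have Uw : uniq [seq [seq v (s i) | i <- enum 'I_n] | s : 'S_n].
  rewrite map_inj_uniq ?enum_uniq // => s t /eq_in_map eq_st.
  by apply/permP => i; apply/v_inj/eq_st; rewrite mem_enum.
apply: uniq_perm; rewrite ?permutations_uniq //.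
apply: (uniq_min_size Uw _ _).2 => [w /mapP[s _ ->]|].
  rewrite mem_permutations map_comp; apply: perm_map; apply: uniq_perm.
  - by rewrite map_inj_uniq ?enum_uniq //; apply: perm_inj.
  - exact: enum_uniq.
  move=> i; rewrite mem_enum; apply/mapP; exists ((s^-1)%g i); rewrite ?mem_enum //.
  by rewrite permKV.
rewrite size_permutations; last by rewrite map_inj_uniq ?enum_uniq.
rewrite size_image size_map -cardE card_ord.
by rewrite -(card_Sn n).
Qed.

(** The letter [x] is a sentinel: the ascent from it is automatic, so the words counted are those
    that alternate beginning with a descent. *)
Lemma card_zigzag n (v : 'I_n -> int) x :
    injective v -> (forall i, x < v i) ->
  (\sum_(s : 'S_n) zigzag false x [seq v (s i) | i <- enum 'I_n])%N =
  entringer n n.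
Proof.
move=> v_inj x_min; set w := [seq v i | i <- enum 'I_n].
have Uw : uniq w by rewrite map_inj_uniq ?enum_uniq.
have x_w : x \notin w by apply/mapP => -[i _ eq_x]; move: (x_min i); rewrite -eq_x ltxx.
have -> : entringer n n = count (zigzag false x) (permutations w).
  rewrite count_zigzag // size_map -cardE card_ord [rank _ _](_ : _ = 0%N) ?subn0 //.
  apply/eqP; rewrite -leqn0 leqNgt -has_count; apply/hasPn => _ /mapP[i _ ->].
  by rewrite -leNgt ltW.
rewrite -(seq.permP (perm_words v_inj)) count_map -sum1_count.
rewrite big_enum_cond [RHS]big_mkcond.
by apply: eq_bigr => s _ /=; case: zigzag.
Qed.

Lemma window_ltn n (p : signed_perm n) i : - n.+1%:Z < window p i.
Proof. by have := absz_window p i; have := ltn_ord (p.1 i); lia. Qed.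

(** Entries are at least -n, so -(n+1) can serve as sentinel. It shifts positions by one, whence the
    initial ascent, and also covers the empty window. *)
Lemma alternating_zigzag n (p : signed_perm n) :
  alternating p = zigzag false (- n.+1%:Z) [seq window p i | i <- enum 'I_n].
Proof.
have nth_w (i : 'I_n) : nth 0 [seq window p i | i <- enum 'I_n] i = window p i.
  by rewrite (nth_map i) ?size_enum_ord // nth_ord_enum.
apply/forallP/zigzagP => [alt [|i]|zz i].
- rewrite size_map size_enum_ord => n_gt0.
  by rewrite /= (nth_w (Ordinal n_gt0)) window_ltn.
- rewrite size_map size_enum_ord => lt_i.
  have /forallP/(_ (Ordinal lt_i)) := alt (Ordinal (ltnW lt_i)).
  rewrite /= eqxx /= (nth_w (Ordinal lt_i)) (nth_w (Ordinal (ltnW lt_i))).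
  by case: odd.
apply/forallP => j; apply/implyP => /eqP eq_j.
have := zz i.+1; rewrite size_map size_enum_ord -eq_j ltn_ord => /(_ isT) /=.
by rewrite eq_j /= nth_w -eq_j nth_w; case: odd.
Qed.

(* Indexing the signs by values instead of positions makes the set of letters
   of the window independent of s. *)
Lemma card_alternating n :
  #|[set p : signed_perm n | alternating p]| = (2 ^ n * entringer n n)%N.
Proof.
rewrite -sum1dep_card big_mkcond /=.
rewrite -(pair_bigA_idem _ (fun s e => if alternating (s, e) then 1 else 0))%N //=.
pose signs_at (s : 'S_n) (e : {ffun 'I_n -> bool}) := [ffun i => e (s i)].
have signs_bij s : bijective (signs_at s).
  by exists (signs_at (s^-1)%g) => e; apply/ffunP => i; rewrite !ffunE ?permK ?permKV.
under eq_bigr => s _ do rewrite (reindex _ (onW_bij _ (signs_bij s))) /=.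
have -> : (2 ^ n = #|{: {ffun 'I_n -> bool}}|)%N.
  by rewrite card_ffun card_bool card_ord.
rewrite exchange_big /= -sum_nat_const; apply: eq_bigr => e _.
pose v (k : 'I_n) : int := (-1) ^+ e k * k.+1%:Z.
rewrite -(@card_zigzag n v (- n.+1%:Z)); last first.
- move=> i; rewrite /v; have := ltn_ord i.
  by case: (e i) => /=; rewrite ?expr0 ?expr1; lia.
- by move=> i j /(congr1 absz); rewrite !abszMsign /= => -[eq_ij]; apply: val_inj.
apply: eq_bigr => s _; rewrite alternating_zigzag.
rewrite (_ : map _ _ = [seq v (s i) | i <- enum 'I_n]); first by case: zigzag.
by apply: eq_map => i; rewrite /window /= ffunE.
Qed.

(** * Products and quotients of power series *)

Definition trunc_poly (n : nat) (f : fps) : {poly rat} := \poly_(i < n.+1) f i.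

Lemma coef_trunc_mul n (f g : fps) (p q : {poly rat}) i :
  (forall j, (j <= n)%N -> p`_j = f j) -> (forall j, (j <= n)%N -> q`_j = g j) ->
  (i <= n)%N -> (p * q)`_i = (f * g)%F i.
Proof.
move=> pf qg le_in; rewrite coefM; apply: eq_bigr => j _.
by rewrite pf ?qg //; have := ltn_ord j; lia.
Qed.

(** Coefficient [n] of a product depends only on coefficients up to [n], so associativity is
    inherited from polynomials by truncation. *)
Lemma fps_mulA f g h : (f * (g * h) =1 f * g * h)%F.
Proof.
move=> n; have cf k j : (j <= n)%N -> (trunc_poly n k)`_j = k j.
  by move=> le_jn; rewrite coef_poly ltnS le_jn.
have cfM k l j : (j <= n)%N -> (trunc_poly n k * trunc_poly n l)`_j = (k * l)%F j.
  exact: coef_trunc_mul (cf k) (cf l).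
rewrite -(coef_trunc_mul (cf f) (cfM g h) (leqnn n)) mulrA.
exact: coef_trunc_mul (cfM f g) (cf h) (leqnn n).
Qed.

Lemma fps_mul_eq f f' g g' : f =1 f' -> g =1 g' -> (f * g =1 f' * g')%F.
Proof. by move=> ff' gg' n; apply: eq_bigr => i _; rewrite ff' gg'. Qed.

Lemma fps_mul1 f : (f * 1 =1 f)%F.
Proof.
move=> n; rewrite /fps_mul big_ord_recr /= subnn mulr1 big1 ?add0r // => i _.
by rewrite /fps_one subn_eq0 leqNgt ltn_ord mulr0.
Qed.

Lemma fps_div_uniq f g h : g 0%N != 0 -> (g * f =1 h)%F -> (f =1 h / g)%F.
Proof.
move=> g0 gf n; rewrite -(fps_mul_eq gf (frefl _)) -fps_mulA.
rewrite (fps_mul_eq (frefl g) (fps_mulC f _)) fps_mulA.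
by rewrite (fps_mul_eq (fps_mulfV g0) (frefl f)) fps_mulC fps_mul1.
Qed.

(** * Solving the Entringer recursion by binomial sums *)

(** These are the derivatives of order [i] of cosine and sine at 0; the two shift lemmas express
    cos' = -sin and sin' = cos. *)
Definition cos_sign (i : nat) : rat := if odd i then 0 else (-1) ^+ i./2.
Definition sin_sign (i : nat) : rat := if odd i then (-1) ^+ i./2 else 0.

Lemma cos_signS i : cos_sign i.+1 = - sin_sign i.
Proof.
rewrite /cos_sign /sin_sign /= uphalf_half; case: (odd i) => /=; last by rewrite oppr0.
by rewrite exprS mulN1r.
Qed.

Lemma sin_signS i : sin_sign i.+1 = cos_sign i.
Proof. by rewrite /cos_sign /sin_sign /= uphalf_half; case: (odd i). Qed.

(** At [k = n] this is n! times the coefficient of x^n in the product of the exponential generating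
    functions of [c] and of the Euler numbers. The parameter [k] lets it follow the Entringer
    triangle from [k = 0]. *)
Definition bin_conv (c : nat -> rat) (n k : nat) : rat :=
  \sum_(i < k.+1) c i * 'C(k, i)%:R * (entringer (n - i) (n - i))%:R.

(** Pascal's rule: the terms carrying 'C(k, i) are reindexed, which shifts [c] and lowers [n], in
    parallel with [entringerS]. *)
Lemma bin_convS c n k : (k <= n)%N ->
  bin_conv c n.+1 k.+1 = bin_conv c n.+1 k + bin_conv (fun i => c i.+1) n k.
Proof.
move=> le_kn; rewrite /bin_conv big_ord_recl [in RHS]big_ord_recl /=.
rewrite -addrA; congr (_ + _); first by rewrite !bin0.
rewrite (eq_bigr (fun i : 'I_k.+1 => 
   c i.+1 * 'C(k, i.+1)%:R * (entringer (n - i) (n - i))%:R +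
   c i.+1 * 'C(k, i)%:R * (entringer (n - i) (n - i))%:R)); last first.
  by move=> i _; rewrite binS natrD subSS; ring.
rewrite big_split /=; congr (_ + _).
by rewrite big_ord_recr /= bin_small // mulr0 mul0r addr0.
Qed.

Lemma entringerS n j :
  entringer n.+1 j.+1 = (entringer n.+1 j + entringer n (n - j))%N.
Proof. by rewrite /= big_ord_recr. Qed.

(* The terms at k = n come from the boundary value entringer n 0 = (n == 0). *)
Lemma entringer_conv k n : (k <= n)%N ->
  (entringer n (n - k))%:R =
    bin_conv cos_sign n k - (k == n)%:R * sin_sign n /\
  (entringer n k)%:R = bin_conv sin_sign n k + (k == n)%:R * cos_sign n.
Proof.
elim: k n => [|k IHk] n.
  rewrite /bin_conv !big_ord1 subn0 bin0; case: n => [|n] _.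
    by rewrite /cos_sign /sin_sign /= !expr0; split; ring.
  by rewrite /cos_sign /sin_sign /= big_ord0 expr0; split; ring.
case: n => // n; rewrite ltnS => le_kn.
have [IHd IHe] := IHk _ (leqW le_kn); have [IHd' IHe'] := IHk _ le_kn.
have kSn : (k == n.+1) = false by apply/eqP; lia.
rewrite kSn !mul0r subr0 addr0 in IHd IHe.
rewrite eqSS cos_signS sin_signS !bin_convS // entringerS natrD IHe IHd'.
rewrite subSS -IHd subSn // entringerS.
rewrite natrD subKn // IHe'.
rewrite (_ : bin_conv (fun i => cos_sign i.+1) n k = - bin_conv sin_sign n k);
  last first.
  by rewrite /bin_conv -sumrN; apply: eq_bigr => i _; rewrite cos_signS; ring.
rewrite (_ : bin_conv (fun i => sin_sign i.+1) n k = bin_conv cos_sign n k);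
  last by apply: eq_bigr => i _; rewrite sin_signS.
by split; ring.
Qed.

(** The first identity of [entringer_conv] at [k = n], divided by n!: its left side [entringer n 0]
    yields the series 1, and its boundary term yields the sine. *)
Lemma cos_mul_entringer :
  (fps_cos * egf (fun n => entringer n n) =1 1 + fps_sin)%F.
Proof.
move=> n; have nz m : m`!%:R != 0 :> rat by rewrite pnatr_eq0 -lt0n fact_gt0.
have [] := entringer_conv (leqnn n); rewrite subnn eqxx mul1r => def_n _.
apply: (mulIf (nz n)); transitivity (bin_conv cos_sign n n).
  rewrite mulr_suml; apply: eq_bigr => i _.
  have le_in : (i <= n)%N by rewrite -ltnS.
  rewrite -(bin_fact le_in) !natrM /fps_cos /cos_sign /egf.
  by case: (odd i); field; rewrite ?nz.
rewrite -[LHS](subrK (sin_sign n)) -def_n mulrDl; congr (_ + _).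
  by case: n {def_n} => [|n]; rewrite /fps_one /= ?big_ord0 ?mul0r.
by rewrite /fps_sin /sin_sign; case: (odd n); rewrite ?mul0r ?divfK.
Qed.

Lemma sec_add_tan : (egf (fun n => entringer n n) =1 fps_sec + fps_tan)%F.
Proof.
have cos0 : fps_cos 0%N != 0 by [].
move=> n; rewrite (fps_div_uniq cos0 cos_mul_entringer) /fps_sec /fps_tan.
rewrite /fps_mul /fps_add -big_split /=; apply: eq_bigr => i _.
by rewrite mulrDl.
Qed.

(** * The involution changing the sign of the entry of absolute value 1 *)

(** As [p.1] is 0-based, its value 0 marks the entry of absolute value 1. *)
Definition flip1 n (p : signed_perm n) : signed_perm n :=
  (p.1, [ffun i => (p.1 i == 0%N :> nat) (+) p.2 i]).

Lemma flip1K n : involutive (@flip1 n).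
Proof.
by case=> s e; congr (_, _); apply/ffunP => i; rewrite !ffunE /= addbA addbb.
Qed.

(* Only the sign of the entry of least absolute value changes, so the order of
   [window p i] and [+-window p j] is unaffected. *)
Lemma window_flip1_lt n (p : signed_perm n) i j (b : bool) : i != j ->
  (window (flip1 p) i < (-1) ^+ b * window (flip1 p) j) =
  (window p i < (-1) ^+ b * window p j).
Proof.
move=> neq_ij; rewrite /window /= !ffunE.
have : (p.1 i != p.1 j :> nat) by rewrite (inj_eq val_inj) (inj_eq perm_inj).
move: (p.2 i) (p.2 j) (nat_of_ord (p.1 i)) (nat_of_ord (p.1 j)).
by case: b => -[] [] [|x] [|y] //= _; rewrite ?expr0 ?expr1; lia.
Qed.

Lemma alternating_flip1 n (p : signed_perm n) :
  alternating (flip1 p) = alternating p.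
Proof.
apply: eq_forallb => i; apply: eq_forallb => j.
have [eq_j /=|//] := eqVneq (j : nat) i.+1.
have neq_ij : i != j by apply/eqP => eq_ij; move: eq_j; rewrite eq_ij; lia.
have := @window_flip1_lt n p i j false neq_ij; rewrite expr0 !mul1r => ->.
have := @window_flip1_lt n p j i false; rewrite expr0 !mul1r eq_sym => -> //.
Qed.

Lemma odd_neg_flip1 n (p : signed_perm n.+1) :
  odd #|[set i | window (flip1 p) i < 0]| = ~~ odd #|[set i | window p i < 0]|.
Proof.
(* The position of the entry 1 or -1; away from it the two sets agree. *)
pose i0 := (p.1^-1)%g ord0.
rewrite [in LHS](cardsD1 i0) [in RHS](cardsD1 i0) !inE !window_lt0 ffunE.
rewrite /i0 permKV eqxx /= !oddD !oddb -/i0.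
rewrite (_ : _ :\ _ = [set i | window p i < 0] :\ i0); last first.
  apply/setP => i; rewrite !inE !window_lt0 ffunE.
  have [//|neq_i /=] := eqVneq i i0.
  case: eqP => // p0; case/eqP: neq_i; apply: (@perm_inj _ p.1).
  by rewrite permKV; apply: val_inj.
by rewrite addNb.
Qed.

Lemma odd_invB_flip1 n (p : signed_perm n.+1) :
  odd (invB (flip1 p)) = ~~ odd (invB p).
Proof.
rewrite /invB oddD odd_neg_flip1 [in RHS]oddD addbN; congr (~~ (odd (_ + _) (+) _)).
  apply: eq_card => -[i j]; rewrite !inE /=; apply: andb_id2l => lt_ij.
  have := @window_flip1_lt _ p j i false; rewrite expr0 !mul1r; apply.
  by rewrite neq_ltn lt_ij orbT.
apply: eq_card => -[i j]; rewrite !inE /=; apply: andb_id2l => lt_ij.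
have := @window_flip1_lt _ p j i true; rewrite expr1 !mulN1r; apply.
by rewrite neq_ltn lt_ij orbT.
Qed.

Lemma card_flip1_half n (Q : pred (signed_perm n)) :
  (forall p, Q (flip1 p) = ~~ Q p) ->
  (#|[set p : signed_perm n | alternating p && Q p]| * 2 =
     #|[set p : signed_perm n | alternating p]| /\
   #|[set p : signed_perm n | alternating p && ~~ Q p]| * 2 =
     #|[set p : signed_perm n | alternating p]|)%N.
Proof.
move=> QN; set A := [set p | _ && Q p]; set B := [set p | _ && ~~ Q p].
have eqAB : #|A| = #|B|.
  rewrite -(card_preimset A (can_inj (@flip1K n))); apply: eq_card => p.
  by rewrite !inE alternating_flip1 QN.
have -> : #|[set p : signed_perm n | alternating p]| = (#|A| + #|B|)%N.
  rewrite -(cardsID [set p | Q p] [set p | alternating p]).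
  by congr (_ + _)%N; apply: eq_card => p; rewrite !inE // andbC.
by rewrite -eqAB; lia.
Qed.

(** * The generating functions *)

Lemma egf_alternating :
  (egf (fun n => #|[set p : signed_perm n | alternating p]|) =1 sec2x + tan2x)%F.
Proof.
move=> n; rewrite /egf card_alternating natrM natrX /fps_add /sec2x /tan2x.
by rewrite /fps_dilate -mulrDr -[_ + _]sec_add_tan mulrA.
Qed.

(** Serves both [in_Bplus] and [in_D]. For positive [n] the involution halves the count; the empty
    signed permutation satisfies [Q] and accounts for the terms +1 and -1. *)
Lemma egf_flip1_half (Q : forall n, pred (signed_perm n)) :
    (forall n (p : signed_perm n.+1), Q n.+1 (flip1 p) = ~~ Q n.+1 p) ->
    (forall p, Q 0%N p) ->
  (egf (fun n => #|[set p : signed_perm n | alternating p && Q n p]|) =1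
     2^-1 *: (sec2x + tan2x + 1))%F /\
  (egf (fun n => #|[set p : signed_perm n | alternating p && ~~ Q n p]|) =1
     2^-1 *: (sec2x + tan2x - 1))%F.
Proof.
(* Doubling and placing [(n == 0)] on the side where it is added keep the counts in [nat], free of
   truncated subtraction. *)
move=> QN Q0; suff E n :
  (#|[set p : signed_perm n | alternating p && Q n p]| * 2 =
     #|[set p : signed_perm n | alternating p]| + (n == 0) /\
   #|[set p : signed_perm n | alternating p && ~~ Q n p]| * 2 + (n == 0) =
     #|[set p : signed_perm n | alternating p]|)%N.
  have nz m : m`!%:R != 0 :> rat by rewrite pnatr_eq0 -lt0n fact_gt0.
  have one n : fps_one n = (n == 0%N)%:R / n`!%:R.
    by case: n => [|n]; rewrite /fps_one ?divr1 ?mul0r.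
  split=> n; have [EQ ENQ] := E n.
    rewrite /fps_scale /fps_add -[_ + tan2x n]egf_alternating one /egf -mulrDl.
    by rewrite -natrD -EQ natrM; field; rewrite nz.
  rewrite /fps_scale /fps_add /fps_opp -[_ + tan2x n]egf_alternating one /egf -ENQ.
  by rewrite natrD natrM; field; rewrite nz.
case: n => [|n]; last by rewrite !addn0; exact: card_flip1_half (QN n).
have cA : #|[set p : signed_perm 0 | alternating p]| = 1%N.
  by rewrite card_alternating.
rewrite cA (_ : [set p | _ && Q _ _] = [set p | alternating p]) ?cA; last first.
  by apply/setP => p; rewrite !inE Q0 andbT.
split=> //; rewrite (_ : [set p | _] = set0) ?cards0 //.
by apply/setP => p; rewrite !inE Q0 andbF.
Qed.

Theorem theorem60 :
  [/\ egf numBplus =1 (2^-1 *: (sec2x + tan2x + 1))%F,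
      egf numBminus =1 (2^-1 *: (sec2x + tan2x - 1))%F,
      egf numD =1 (2^-1 *: (sec2x + tan2x + 1))%F
    & egf numBD =1 (2^-1 *: (sec2x + tan2x - 1))%F].
Proof.
have [||Bp Bm] := @egf_flip1_half (@in_Bplus).
- by move=> n p; rewrite /in_Bplus odd_invB_flip1.
- by move=> p; rewrite /in_Bplus /invB !eq_card0 // => -[] // [].
have [||D BD] := @egf_flip1_half (@in_D).
- by move=> n p; rewrite /in_D odd_neg_flip1.
- by move=> p; rewrite /in_D eq_card0 // => -[].
(* Only [numBminus] is left: [in_Bminus] is the complement of [in_Bplus] up to a double negation. *)
split=> // n; rewrite -Bm; congr (_%:R / _).
by apply: eq_card => p; rewrite !inE /in_Bplus negbK.
Qed.
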